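(* Let $G$ and $H$ be groups. For $n\in\mathbb{Z}^+$ let $W_n=\langle x_1,\dots,x_n,x_1^{-1},\dots,x_n^{-1}\rangle$ be the set of all words (finite strings, repetition allowed) on the symbols $x_1,\dots,x_n,x_1^{-1},\dots,x_n^{-1}$. Let $T_G$ be the set of all functions $G^n\to G$, $(a_1,\dots,a_n)\mapsto f(a_1,\dots,a_n)$, with $n\in\mathbb{Z}^+$ and $f\in W_n$ (the word evaluated in $G$ with $x_i\mapsto a_i$), and let $T_H$ be defined in the same way from $H$. Let $$\theta=\{(\tau_G(f),\tau_H(f)): f\in W_n,\ n\in\mathbb{Z}^+\},$$ where $\tau_G(f):G^n\to G$ and $\tau_H(f):H^n\to H$ are the functions induced by $f\in W_n$. If $X$ and $Y$ are nonempty subsets of $G$ and $H$, respectively, then a map $\phi:\langle X\rangle_{T_G}\to\langle Y\rangle_{T_H}$ is a group homomorphism if and only if $\phi$ is a $\theta$-morphism.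
   Context: An operator gen-semigroup on a set $D$ is a set $T$ of functions $D^n\to D$ ($n\in\mathbb{Z}^+$ arbitrary) such that for every $n$-variable $f\in T$ and all $g_1,\dots,g_n\in T$ ($g_i$ of $n_i$ variables), the composite $f\circ(g_1,\dots,g_n):D^{n_1+\cdots+n_n}\to D$, obtained by substituting $g_1,\dots,g_n$, evaluated on consecutive disjoint blocks of variables, into $f$, lies in $T$. Both $T_G$ and $T_H$ are operator gen-semigroups. For $U\subseteq D$, $\langle U\rangle_T=\{f(u_1,\dots,u_n): n\in\mathbb{Z}^+, f\in T\text{ of }n\text{ variables}, u_i\in U\}$; such sets are called $T$-spaces (in the claim, $\langle X\rangle_{T_G}$ and $\langle Y\rangle_{T_H}$ are the subgroups generated by $X$ and $Y$). For operator gen-semigroups $T_1,T_2$ and a relation $\theta\subseteq T_1\times T_2$, and $f\in\operatorname{Dom}\theta$, the expression $\theta(f)(b_1,\dots,b_n)$ is well-defined if every $g$ with $(f,g)\in\theta$ has $n$ variables and all such $g$ take the same value at $(b_1,\dots,b_n)$; $\theta(f)(b_1,\dots,b_n)$ is then that value. A map $\phi$ from a $T_1$-space $S$ to a $T_2$-space is a $\theta$-morphism if for all $n\in\mathbb{Z}^+$, $(a_1,\dots,a_n)\in S^n$ and $f\in\operatorname{Dom}\theta$ of $n$ variables, $\theta(f)(\phi(a_1),\dots,\phi(a_n))$ is well-defined and $\phi(f(a_1,\dots,a_n))=\theta(f)(\phi(a_1),\dots,\phi(a_n))$. Words are regarded together with the number $n$ of variables of the set $W_n$ they are taken from. *)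

(* Defs.v *)
From HB Require Import structures.
From mathcomp Require Import all_boot all_order.
From mathcomp Require Import boolp classical_sets.

Set Implicit Arguments.
Unset Strict Implicit.
Unset Printing Implicit Defensive.

Local Open Scope classical_set_scope.
Local Open Scope group_scope.

Record operation (D : Type) := Operation {
  arity : nat;
  arity_gt0 : (0 < arity)%N;
  apply_op :> arity.-tuple D -> D }.

Section Composite.
Variables (D : Type) (f : operation D) (g : 'I_(arity f) -> operation D).

Let p_ (i : 'I_(arity f)) := arity (g i).

Lemma composite_arity_gt0 : (0 < \sum_i p_ i)%N.
Proof.
have i0 : 'I_(arity f) by exact: (Ordinal (arity_gt0 f)).
by rewrite (bigD1 i0) //= addn_gt0 arity_gt0.
Qed.

(* [tagnat.Rank i j] is the position of the [j]-th entry of the [i]-th block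
   when blocks of sizes [p_ 0, p_ 1, ...] are laid out consecutively. *)
Definition composite : operation D :=
  Operation composite_arity_gt0 (fun t =>
    f [tuple g i [tuple tnth t (tagnat.Rank i j) | j < arity (g i)]
      | i < arity f]).

End Composite.

Record genSemigroup (D : Type) := GenSemigroup {
  gs_ops :> set (operation D);
  gs_composite : forall f (g : 'I_(arity f) -> operation D),
    gs_ops f -> (forall i, gs_ops (g i)) -> gs_ops (composite g) }.

Definition space (D : Type) (T : genSemigroup D) (U : set D) : set D :=
  [set v | exists2 f, gs_ops T f & exists2 u : (arity f).-tuple D,
     (forall i, U (tnth u i)) & v = f u].

Lemma operation_eq (D : Type) n (h1 h2 : (0 < n)%N) (f1 f2 : n.-tuple D -> D) :
  f1 =1 f2 -> Operation h1 f1 = Operation h2 f2.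
Proof.
by move=> /funext ->; rewrite (bool_irrelevance h1 h2).
Qed.

Lemma space_closed (D : Type) (T : genSemigroup D) (U : set D)
    (f : operation D) (a : (arity f).-tuple D) :
  gs_ops T f -> (forall i, space T U (tnth a i)) -> space T U (f a).
Proof.
move=> Tf aU.
have /choice[g gP] : forall i, exists g, gs_ops T g /\
    exists2 u : (arity g).-tuple D, (forall j, U (tnth u j)) & tnth a i = g u.
  by move=> i; have [g Tg gu] := aU i; exists g.
have /all_sig[u uP] : forall i, {u : (arity (g i)).-tuple D |
    (forall j, U (tnth u j)) /\ tnth a i = g i u}.
  by move=> i; apply: cid; have [_ [u uU au]] := gP i; exists u.
exists (composite g).
  by apply: gs_composite => // i; case: (gP i).
exists [tuple tnth (u (tagnat.sig1 s)) (tagnat.sig2 s)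
       | s < \sum_i arity (g i)].
  by move=> s; rewrite tnth_mktuple; apply: (uP _).1.
rewrite /=; congr (@apply_op _ f _); apply: eq_from_tnth => i.
rewrite tnth_mktuple (uP i).2; congr (@apply_op _ (g i) _).
apply: eq_from_tnth => j; rewrite !tnth_mktuple /tagnat.sig1 /tagnat.sig2.
by rewrite /tagnat.Rank tagnat.rankK.
Qed.

Section Action.
Variables (D : Type) (T : genSemigroup D) (U : set D).

Lemma act_subproof (f : T) (a : (arity (val f)).-tuple (space T U)) :
  val f (map_tuple val a) \in space T U.
Proof.
apply/mem_set/space_closed; first exact: set_mem (valP f).
by move=> i; rewrite tnth_map; exact: set_mem (valP _).
Qed.

Definition act (f : T) (a : (arity (val f)).-tuple (space T U)) : space T U :=
  exist _ (val f (map_tuple val a)) (act_subproof a).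

End Action.

Definition has_value (D : Type) (g : operation D) n (b : n.-tuple D) (v : D) :=
  exists e : n = arity g, g (tcast e b) = v.

Section ThetaMorphism.
Variables (D1 D2 : Type) (T1 : genSemigroup D1) (T2 : genSemigroup D2).
Variable theta : set (T1 * T2)%type.

Definition Dom : set T1 := [set f | exists g, theta (f, g)].

Definition well_defined (f : T1) n (b : n.-tuple D2) :=
  (forall g, theta (f, g) -> arity (val g) = n) /\
  (forall g g' v v', theta (f, g) -> theta (f, g') ->
     has_value (val g) b v -> has_value (val g') b v' -> v = v').

Definition theta_value (f : T1) n (b : n.-tuple D2) (v : D2) :=
  exists2 g, theta (f, g) & has_value (val g) b v.

Definition theta_morphism (U1 : set D1) (U2 : set D2)
    (phi : space T1 U1 -> space T2 U2) :=
  forall (f : T1) (a : (arity (val f)).-tuple (space T1 U1)), Dom f ->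
    let b := map_tuple (fun s => val (phi s)) a in
    well_defined f b /\ theta_value f b (val (phi (act a))).

End ThetaMorphism.

(* The letter [(i, false)] stands for the symbol [x_i] and [(i, true)] for
   the symbol [x_i^-1]; words are not reduced. *)
Definition word (n : nat) := seq ('I_n * bool).

Section WordOperations.
Variable G : groupType.

Definition eval_letter n (a : n.-tuple G) (l : 'I_n * bool) : G :=
  if l.2 then (tnth a l.1)^-1 else tnth a l.1.

Definition eval_word n (w : word n) (a : n.-tuple G) : G :=
  \prod_(l <- w) eval_letter a l.

Definition word_op n (n_gt0 : (0 < n)%N) (w : word n) : operation G :=
  Operation n_gt0 (eval_word w).

Definition word_ops : set (operation G) :=
  [set f | exists n (n_gt0 : (0 < n)%N) (w : word n), f = word_op n_gt0 w].

Definition inv_word n (w : word n) : word n :=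
  rev [seq (l.1, ~~ l.2) | l <- w].

Definition rename_word m n (r : 'I_m -> 'I_n) (w : word m) : word n :=
  [seq (r l.1, l.2) | l <- w].

Lemma eval_inv_word n (w : word n) a : eval_word (inv_word w) a = (eval_word w a)^-1.
Proof.
rewrite /eval_word /inv_word; elim: w => [|[i b] w IHw].
  by rewrite !big_nil invg1.
rewrite rev_cons -cats1 big_cat IHw !big_cons big_nil /= mulg1 invgM; congr (_ * _).
by case: b; rewrite /eval_letter /= ?invgK.
Qed.

Lemma eval_rename_word m n (r : 'I_m -> 'I_n) (w : word m) (a : n.-tuple G) :
  eval_word (rename_word r w) a = eval_word w [tuple tnth a (r i) | i < m].
Proof.
rewrite /eval_word big_map; apply: eq_bigr => -[i b] _.
by rewrite /eval_letter /= tnth_mktuple.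
Qed.

Lemma eval_flatten_word n (s : seq (word n)) (a : n.-tuple G) :
  eval_word (flatten s) a = \prod_(w <- s) eval_word w a.
Proof.
elim: s => [|w s IHs]; first by rewrite /eval_word !big_nil.
by rewrite /= big_cons -IHs /eval_word big_cat.
Qed.

Lemma word_ops_composite f (g : 'I_(arity f) -> operation G) :
  word_ops f -> (forall i, word_ops (g i)) -> word_ops (composite g).
Proof.
move=> [n [n0 [w fE]]]; rewrite fE in g * => {f fE} /= gP.
have /choice[m mP] : forall i, exists m,
    exists (m0 : (0 < m)%N) (v : word m), g i = word_op m0 v.
  by move=> i; exact: gP.
have m0 i : (0 < m i)%N by have [] := mP i.
have /all_sig[v vP] : forall i, {v : word (m i) | g i = word_op (m0 i) v}.
  move=> i; apply: cid; have [h [v ->]] := mP i.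
  by exists v; rewrite (bool_irrelevance h (m0 i)).
have -> : g = fun i => word_op (m0 i) (v i) by apply: funext.
pose sub (l : 'I_n * bool) : word (\sum_i m i) :=
  let u := rename_word (@tagnat.Rank n m l.1) (v l.1) in
  if l.2 then inv_word u else u.
have M0 := composite_arity_gt0 (fun i : 'I_(arity (word_op n0 w)) => word_op (m0 i) (v i)).
exists (\sum_i m i)%N, M0, (flatten [seq sub l | l <- w]).
apply: operation_eq => t; rewrite eval_flatten_word big_map.
apply: eq_bigr => -[i b] _; rewrite /eval_letter /= tnth_mktuple /sub /=.
by case: b; rewrite ?eval_inv_word eval_rename_word.
Qed.

Definition word_gs : genSemigroup G := GenSemigroup word_ops_composite.

Lemma word_gsP n (n_gt0 : (0 < n)%N) (w : word n) : word_op n_gt0 w \in gs_ops word_gs.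
Proof. by apply/mem_set; exists n, n_gt0, w. Qed.

Definition tau n (n_gt0 : (0 < n)%N) (w : word n) : word_gs :=
  exist _ (word_op n_gt0 w) (word_gsP n_gt0 w).

Lemma space_word (X : set G) n (w : word n) (a : n.-tuple G) : (0 < n)%N ->
  (forall i, space word_gs X (tnth a i)) -> space word_gs X (eval_word w a).
Proof.
move=> n0 aX; apply: (@space_closed _ word_gs X (word_op n0 w) a) => //.
by exists n, n0, w.
Qed.

Lemma sub_space (X : set G) : X `<=` space word_gs X.
Proof.
move=> x Xx; exists (word_op (ltn0Sn 0) [:: (ord0, false)]).
  by exists 1%N, (ltn0Sn 0), [:: (ord0, false)].
by exists [tuple x] => [i|]; rewrite ?(tnth_nth x) ?ord1 //= /eval_word big_seq1.
Qed.

Lemma space_group_closed (X : set G) : X !=set0 ->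
  group_closed (fun x => x \in space word_gs X).
Proof.
move=> [x Xx]; split=> [|u v /set_mem Su /set_mem Sv]; apply/mem_set.
  have := @space_word X 1 [::] [tuple x] isT; rewrite /eval_word big_nil; apply.
  by move=> i; rewrite ord1; exact: sub_space.
have := @space_word X 2 [:: (ord0, false); (ord_max, true)] [tuple u; v] isT.
rewrite /eval_word big_cons big_seq1; apply.
by case=> -[|[|//]] i.
Qed.

Lemma space_word_gsE (X : set G) : X !=set0 ->
  space word_gs X = smallest (fun K => group_closed (fun x => x \in K)) X.
Proof.
move=> X0; apply/seteqP; split=> [x|]; last first.
  apply: smallest_sub; first exact: space_group_closed.
  exact: sub_space.
move=> [_ [n [n0 [w ->]]] [u uX ->]] K [Kg XK] /=; apply: set_mem.
rewrite /= in u uX *; rewrite /eval_word; elim: w => [|[i b] w IHw].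
  by rewrite big_nil; exact: Kg.1.
rewrite big_cons; apply: (group_closedM Kg) => //.
have Ku : tnth u i \in K by apply/mem_set/XK/uX.
by rewrite /eval_letter /=; case: b => //; apply: (group_closedV Kg).
Qed.

(* An alias of the type [space word_gs X] carrying the group structure
   inherited from [G]; operations have positive arity, so the empty set spans
   the empty space, which is not a group. *)
Definition space_group (X : set G) (X_neq0 : X !=set0) : Type :=
  space word_gs X.

Section SpaceGroup.
Variables (X : set G) (X_neq0 : X !=set0).
HB.instance Definition _ := SubChoice.copy (space_group X_neq0)
  {x : G | x \in space word_gs X}.
HB.instance Definition _ := SubChoice_isSubGroup.Build G
  (fun x => x \in space word_gs X) (space_group X_neq0)
  (space_group_closed X_neq0).
End SpaceGroup.

End WordOperations.

Definition theta_words (G H : groupType) : set (word_gs G * word_gs H)%type :=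
  [set p | exists n (n_gt0 : (0 < n)%N) (w : word n),
     p = (tau G n_gt0 w, tau H n_gt0 w)].
Arguments theta_words : clear implicits.

Definition group_hom (G H : groupType) (f : G -> H) := {morph f : x y / x * y}.

(* Main.v *)
Require Import Defs.
From mathcomp Require Import all_boot.
From mathcomp Require Import boolp classical_sets.

(** The subgroup generated by a nonempty set is a group whose inclusion into
    the ambient group is a homomorphism, and homomorphisms commute with the
    evaluation of words ([group_hom_eval_word]).  Writing [w(a)] for the value
    of the word [w] at the tuple [a], a homomorphism [phi] thus satisfies
    [phi (w(a)) = w(phi a)] for every word [w].  If several words [w] induce
    the same function [f] on [G], the values [w(phi a)] all equal
    [phi (f(a))], although those words may induce different functions on [H];
    this makes [theta(f)] well defined at [phi a], with the required value.

    Conversely, if [phi] is a theta-morphism, well-definedness makes every word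
    [w] that induces [f] a legitimate representative of [theta(f)], so that
    [phi (w(a)) = w(phi a)] for all [w] ([theta_morphism_eval_word]); the word
    [x_1 x_2] gives multiplicativity. *)

Set Implicit Arguments.
Unset Strict Implicit.
Unset Printing Implicit Defensive.

Local Open Scope classical_set_scope.
Local Open Scope group_scope.

Lemma has_value_inj (D : Type) (g : operation D) n (b : n.-tuple D) v v' :
  has_value g b v -> has_value g b v' -> v = v'.
Proof. by move=> [e <-] [e' <-]; rewrite (eq_irrelevance e e'). Qed.

Section GroupHomWords.
Variables (G H : groupType) (f : G -> H).
Hypothesis f_hom : group_hom f.

Lemma group_hom1 : f 1 = 1.
Proof. by apply: (mulgI (f 1)); rewrite -f_hom !mulg1. Qed.

Lemma group_homV x : f x^-1 = (f x)^-1.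
Proof. by apply: (mulgI (f x)); rewrite -f_hom !mulgV group_hom1. Qed.

Lemma group_hom_eval_word n (w : word n) (a : n.-tuple G) :
  f (eval_word w a) = eval_word w (map_tuple f a).
Proof.
rewrite /eval_word (big_morph f f_hom group_hom1); apply: eq_bigr => -[i b] _.
by rewrite /eval_letter /= tnth_map; case: b; rewrite ?group_homV.
Qed.

End GroupHomWords.

Section WordSpaces.
Variables (G : groupType) (X : set G) (X_neq0 : X !=set0).

Lemma val_space_group_hom : group_hom (val : space_group X_neq0 -> G).
Proof. by []. Qed.

(** Because the inclusion is a homomorphism, a word may be evaluated inside the
    generated subgroup instead of the ambient group; this lets a map defined
    only on the subgroup be compared with words. *)
Lemma act_tau n (n_gt0 : (0 < n)%N) (w : word n)
    (a : n.-tuple (space (word_gs G) X)) :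
  act (f := tau G n_gt0 w) a = eval_word w (a : n.-tuple (space_group X_neq0)).
Proof.
apply: val_inj; apply: esym.
exact: (group_hom_eval_word (@val_space_group_hom)).
Qed.

End WordSpaces.

Section ThetaWords.
Variables (G H : groupType) (X : set G) (Y : set H).
Variable phi : space (word_gs G) X -> space (word_gs H) Y.

Let phi_tuple n (a : n.-tuple (space (word_gs G) X)) : n.-tuple H :=
  map_tuple (fun s => val (phi s)) a.

(** The value does not depend on the representative [g], which is what makes
    [theta(f)] well defined along a homomorphism. *)
Lemma group_hom_theta_value (X_neq0 : X !=set0) (Y_neq0 : Y !=set0)
    (f : word_gs G) (g : word_gs H)
    (a : (arity (val f)).-tuple (space (word_gs G) X)) :
  group_hom (phi : space_group X_neq0 -> space_group Y_neq0) ->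
  theta_words G H (f, g) ->
  has_value (val g) (phi_tuple a) (val (phi (act (f := f) a))).
Proof.
move=> phi_hom [n [n_gt0 [w [fE gE]]]]; subst f g.
have phiv_hom : group_hom (fun s : space_group X_neq0 => val (phi s)).
  by move=> x y /=; rewrite phi_hom.
exists erefl; rewrite tcast_id (act_tau X_neq0).
exact/esym/(group_hom_eval_word phiv_hom).
Qed.

Lemma theta_morphism_eval_word n (n_gt0 : (0 < n)%N) (w : word n)
    (a : n.-tuple (space (word_gs G) X)) :
  theta_morphism (theta_words G H) phi ->
  val (phi (act (f := tau G n_gt0 w) a)) = eval_word w (phi_tuple a).
Proof.
have thw : theta_words G H (tau G n_gt0 w, tau H n_gt0 w).
  by exists n, n_gt0, w.
have dom : Dom (theta_words G H) (tau G n_gt0 w) by exists (tau H n_gt0 w).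
case/(_ (tau G n_gt0 w) a dom) => -[_ wd] [g thg gv].
(* [g] may be induced by a word other than [w]: the two words may induce
   different functions, but well-definedness equates their values at the
   image of [a]. *)
by apply: (wd _ _ _ _ thg thw gv); exists erefl; rewrite tcast_id.
Qed.

End ThetaWords.

Theorem proposition8p5p11 (G H : groupType) (X : set G) (Y : set H)
    (X_neq0 : X !=set0) (Y_neq0 : Y !=set0)
    (phi : space (word_gs G) X -> space (word_gs H) Y) :
  group_hom (phi : space_group X_neq0 -> space_group Y_neq0) <->
  theta_morphism (theta_words G H) phi.
Proof.
split=> [phi_hom f a [g0 thg0] b | phi_theta x y].
  have val_b g (thg : theta_words G H (f, g)) :=
    group_hom_theta_value a phi_hom thg.
  split; last by exists g0 => //; exact: val_b.
  split=> [g thg | g g' v v' thg thg' gv gv'].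
    by have [e _] := val_b g thg.
  by rewrite (has_value_inj gv (val_b g thg)) (has_value_inj gv' (val_b g' thg')).
pose w : word 2 := [:: (ord0, false); (ord_max, false)].
have evalw (K : groupType) (c : 2.-tuple K) :
    eval_word w c = tnth c ord0 * tnth c ord_max.
  by rewrite /eval_word big_cons big_seq1.
have := theta_morphism_eval_word (ltn0Sn 1) w [tuple x; y] phi_theta.
rewrite (act_tau X_neq0) !evalw => phiM.
exact: val_inj.
Qed.
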